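(* Let $\Pi$ be a projective plane of order $q$ that contains an oval and has a polarity $\pi$, and let $G_\pi$ be the corresponding polarity graph. If $m \in \{1,2,\dots,q+1\}$, then $G_\pi$ contains a subgraph on at most $m + \binom{m}{2}$ vertices that has at least \[ 2\binom{m}{2} + \frac{m^4}{8q} - O\!\left(\frac{m^4}{q^{3/2}} + m\right) \] edges, where the implied constant in the $O(\cdot)$ term is absolute (independent of $q$, $m$, $\Pi$ and $\pi$).
   Context: A finite geometry is a triple $(\mathcal{P},\mathcal{L},\mathcal{I})$ with $\mathcal{P}$ (points) and $\mathcal{L}$ (lines) disjoint finite sets and $\mathcal{I}\subset \mathcal{P}\times\mathcal{L}$ an incidence relation. A projective plane of order $q$ is such a geometry in which every line contains $q+1$ points, every point lies on $q+1$ lines, any two distinct points lie on a unique common line and any two distinct lines meet in a unique point (so there are $q^2+q+1$ points). An oval in a projective plane of order $q$ is a set of $q+1$ points no three of which are collinear. A polarity is a bijection $\pi$ of $\mathcal{P}\cup\mathcal{L}$ that maps points to lines and lines to points, is an involution, and preserves incidence. The polarity graph $G_\pi$ has vertex set $\mathcal{P}$ and edge set $\{\{p,r\} : p,r\in\mathcal{P},\ (p,\pi(r))\in\mathcal{I}\}$; in particular it has a loop at each absolute point $p$, i.e. each point with $(p,\pi(p))\in\mathcal{I}$. *)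

(* Defs.v *)
From mathcomp Require Import all_boot all_order all_algebra.
From mathcomp Require Import reals exp.

Set Implicit Arguments.
Unset Strict Implicit.
Unset Printing Implicit Defensive.

Record geometry := Geometry {
  point : finType;
  line : finType;
  incident : point -> line -> bool
}.

Record projective_plane (q : nat) (G : geometry) : Prop := ProjectivePlane {
  card_line : forall l : line G, #|[set p : point G | incident p l]| = q.+1;
  card_pencil : forall p : point G, #|[set l : line G | incident p l]| = q.+1;
  unique_join : forall p r : point G, p <> r ->
    exists! l : line G, incident p l /\ incident r l;
  unique_meet : forall l k : line G, l <> k ->
    exists! p : point G, incident p l /\ incident p k
}.

Definition collinear (G : geometry) (x y z : point G) : Prop :=
  exists l : line G, [/\ incident x l, incident y l & incident z l].

Definition oval (q : nat) (G : geometry) (O : {set point G}) : Prop :=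
  #|O| = q.+1 /\
  forall x y z : point G, x \in O -> y \in O -> z \in O ->
    x <> y -> y <> z -> x <> z -> ~ collinear x y z.

(* The disjoint union of points and lines is the sum type; incidence becomes
   a symmetric relation on it, false between two points or two lines. *)
Definition element (G : geometry) : Type := (point G + line G)%type.

Definition incident_elt (G : geometry) (x y : element G) : bool :=
  match x, y with
  | inl p, inr l => incident p l
  | inr l, inl p => incident p l
  | _, _ => false
  end.

Record polarity (G : geometry) (pi : element G -> element G) : Prop :=
  Polarity {
  polarity_bij : bijective pi;
  polarity_point : forall p : point G, exists l : line G, pi (inl p) = inr l;
  polarity_line : forall l : line G, exists p : point G, pi (inr l) = inl p;
  polarity_invol : involutive pi;
  polarity_incident : forall x y : element G,
    incident_elt (pi x) (pi y) = incident_elt x y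
}.

(* Edges are unordered pairs {p, r}; a loop at an absolute point p is the
   singleton {p}, and counts as one edge. *)
Definition polarity_edges (G : geometry) (pi : element G -> element G) :
    {set {set point G}} :=
  [set e : {set point G} | [exists p : point G, exists r : point G,
     (e == [set p; r]) && incident_elt (inl p) (pi (inl r))]].

(* (V, F) is a subgraph, not necessarily induced, of the graph on T with
   edge set E. *)
Definition subgraph (T : finType) (E : {set {set T}})
    (V : {set T}) (F : {set {set T}}) : Prop :=
  F \subset E /\ forall e : {set T}, e \in F -> e \subset V.

(* Main.v *)
Require Import Defs.
From mathcomp Require Import all_boot all_order all_algebra.
From mathcomp Require Import reals exp.
From mathcomp Require Import zify ring lra.

Set Implicit Arguments.
Unset Strict Implicit.
Unset Printing Implicit Defensive.

Import Order.TTheory GRing.Theory Num.Theory.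

(**
In the polarity graph every vertex has q + 1 neighbours and two distinct
vertices have exactly one common neighbour. Given m points A of an oval O, each
pair of points of A has a pole (its common neighbour); distinct pairs have
distinct poles since no three points of O are collinear. The points of A with
these poles span about 2 C(m,2) edges between A and the poles. A variance
(expander mixing) estimate for the C(q+1,2) poles of O shows that they span
q^3/8 - O(q^(5/2)) edges, all but O(q^2) of which come from two disjoint pairs
of O. Averaging over A, such an edge survives with frequency
m(m-1)(m-2)(m-3) / ((q+1)q(q-1)(q-2)), so some A gains
m^4/(8q) - O(m^4/q^(3/2) + m) edges between poles.
*)

(** * Averaging over subsets, and unordered pairs *)

(* Points are removed from O one at a time, each time the one that costs least. *)
Lemma sub_card_averaging (T X : finType) (E : {set X}) (S : X -> {set T})
    (O : {set T}) (k m : nat) :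
  (forall x, x \in E -> #|S x| = k) ->
  (forall x, x \in E -> S x \subset O) ->
  m <= #|O| ->
  exists A : {set T}, [/\ A \subset O, #|A| = m &
    #|E| * m ^_ k <= #|[set x in E | S x \subset A]| * #|O| ^_ k].
Proof.
move=> Sk SO; move Dj: (#|O| - m) => j; elim: j m Dj => [|j IHj] m Dj mO.
  exists O; have -> : m = #|O| by lia.
  split=> //; rewrite leq_mul2r subset_leq_card ?orbT //.
  by apply/subsetP=> x xE; rewrite inE xE SO.
have [||A [AO cA leA]] := IHj m.+1; [lia | lia |].
pose N (B : {set T}) := #|[set x in E | S x \subset B]|.
(* A set [S x] inside [A] survives the removal of [v] exactly when [v] is one of the [m.+1 - k]
   points of [A] outside [S x]. *)
have sumN : \sum_(v in A) N (A :\ v) = N A * (m.+1 - k).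
  have NE v : N (A :\ v) = \sum_(x in E | S x \subset A) (v \notin S x).
    rewrite /N -sum1_card [RHS]big_mkcond [LHS]big_mkcond /=.
    apply: eq_bigr => x _; rewrite inE subsetD1.
    by case: (x \in E) => //=; case: (S x \subset A); case: (v \in S x).
  under eq_bigr => v _ do rewrite NE.
  rewrite exchange_big /= (eq_bigr (fun=> m.+1 - k)); last first.
    move=> x /andP[xE xA]; rewrite -cA -(Sk _ xE) -{2}(setIidPr xA) -cardsD.
    rewrite -sum1_card [RHS]big_mkcond [LHS]big_mkcond /=.
    by apply: eq_bigr => v _; rewrite inE andbC; case: (v \in A); case: (_ \in S x).
  rewrite sum_nat_const; congr (_ * _).
  by apply: eq_card => x; rewrite !inE.
have [v vA Nv] : exists2 v, v \in A & N A * (m.+1 - k) <= m.+1 * N (A :\ v).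
  have /card_gt0P [v0 v0A] : 0 < #|A| by rewrite cA.
  have [v vA vmax] := @arg_maxnP _ v0 (mem A) (fun v => N (A :\ v)) v0A.
  exists v => //; rewrite -sumN -cA -sum_nat_const.
  by apply: leq_sum => w wA; apply: vmax.
exists (A :\ v); split.
- exact: subset_trans (subD1set _ _) AO.
- by have := cardsD1 v A; rewrite vA cA => -[].
rewrite -(leq_pmul2l (ltn0Sn m)).
(* Both [m.+1 * m ^_ k] and [m.+1 ^_ k * (m.+1 - k)] equal [m.+1 ^_ k.+1]. *)
rewrite mulnCA -ffactSS ffactnSr !mulnA.
apply: leq_trans (_ : N A * #|O| ^_ k * (m.+1 - k) <= _).
  by rewrite leq_mul2r leA orbT.
by rewrite mulnAC leq_mul2r Nv orbT.
Qed.

(** An unordered pair comes from at most two ordered ones, and a loop from only one. *)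
Lemma card_unordered_pairs (T : finType) (D : {set T * T}) :
  #|D| <= 2 * #|[set [set x.1; x.2] | x in D]|.
Proof.
rewrite -sum1_card (partition_big_imset (fun x => [set x.1; x.2])) /=.
rewrite mulnC -sum_nat_const; apply: leq_sum => e /imsetP[[p r] _ ->] /=.
apply: leq_trans (_ : #|[set (p, r); (r, p)]| <= 2); last first.
  by rewrite cards2; case: (_ != _).
rewrite sum1dep_card; apply: subset_leq_card; apply/subsetP => -[x y].
rewrite !inE /= => /andP[_ /eqP/setP exy].
move: (exy x) (exy y) (exy p) (exy r).
rewrite !inE !eqxx !orbT.
move=> /esym/orP[]/eqP hx /esym/orP[]/eqP hy /orP[]/eqP hp /orP[]/eqP hr;
  by rewrite !xpair_eqE; apply/orP; (left + right); apply/andP; split; apply/eqP; congruence.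
Qed.

(** * Degree and codegree counts *)

Section PolarityGraph.

Variables (T : finType) (a : rel T) (q : nat).
Hypothesis a_sym : symmetric a.
Hypothesis a_deg : forall p, \sum_r a p r = q.+1.
Hypothesis a_codeg : forall p p', p != p' -> \sum_r (a p r * a p' r) = 1.

Definition nbrs (Y : {set T}) (r : T) : nat := \sum_(v in Y) a v r.

Lemma sum_nbrs Y : \sum_r nbrs Y r = #|Y| * q.+1.
Proof.
by rewrite exchange_big /= (eq_bigr (fun=> q.+1)) ?sum_nat_const.
Qed.

Lemma sum_codeg v (Y : {set T}) : v \in Y ->
  \sum_(w in Y) \sum_r (a v r * a w r) = q + #|Y|.
Proof.
move=> vY; rewrite (bigD1 v) //= (eq_bigr (fun r => nat_of_bool (a v r))); last first.
  by move=> r _; case: (a v r).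
rewrite a_deg (eq_bigr (fun=> 1)); last by move=> w /andP[_ wv]; rewrite a_codeg // eq_sym.
rewrite sum1dep_card addSnnS; congr (_ + _); rewrite (cardsD1 v Y) vY add1n; congr _.+1.
by apply: eq_card => x; rewrite !inE andbC.
Qed.

Lemma sum_nbrs2 Y : \sum_r nbrs Y r ^ 2 = #|Y| * (q + #|Y|).
Proof.
rewrite -sum_nat_const.
rewrite (eq_bigr (fun r => \sum_(v in Y) \sum_(w in Y) (a v r * a w r))).
  rewrite exchange_big /=; apply: eq_bigr => v vY.
  by rewrite exchange_big /= sum_codeg.
by move=> r _; rewrite -mulnn big_distrl /=; apply: eq_bigr => v _; rewrite big_distrr.
Qed.

(** Of the (q + 1)^2 walks of length two from [p], q + 1 return to [p] and exactly one ends at each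
    other vertex. *)
Lemma card_vertices (p : T) : #|T| = q ^ 2 + q + 1.
Proof.
have h : \sum_(w in [set: T]) \sum_r (a p r * a w r) = q + #|T|.
  by rewrite sum_codeg ?inE // cardsT.
have : \sum_(w in [set: T]) \sum_r (a p r * a w r) = q.+1 * q.+1.
  rewrite exchange_big /= -{1}(a_deg p) big_distrl /=; apply: eq_bigr => r _.
  rewrite -big_distrr /= -(a_deg r); congr (_ * _).
  by apply: eq_big => w; rewrite ?inE // a_sym.
by rewrite h -mulnn; lia.
Qed.

(** If n is at most 2, then n^2 - n is 2 for n = 2 and 0 otherwise, so the first two moments of
    [nbrs O] give the count. *)
Lemma card_secants (O : {set T}) : (forall r, nbrs O r <= 2) ->
  #|[set r | nbrs O r == 2]| = 'C(#|O|, 2).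
Proof.
move=> O2; rewrite bin2; set t := #|_|.
suff e : t.*2 + #|O| * q.+1 = #|O| * (q + #|O|).
  have -> : #|O| * #|O|.-1 = t.*2 by case: #|O| e => [|k]; nia.
  by rewrite doubleK.
rewrite -sum_nbrs -sum_nbrs2 -muln2 -sum_nat_const big_mkcond -big_split /=.
apply: eq_bigr => r _; rewrite inE; have := O2 r.
by case: (nbrs O r) => [|[|[|]]].
Qed.


(** * Poles and adjacent pairs of poles *)

Definition trace (A : {set T}) (p : T) : {set T} := [set v in A | a v p].

Lemma card_trace A p : #|trace A p| = nbrs A p.
Proof.
rewrite -sum1_card big_mkcond /nbrs [RHS]big_mkcond /=.
by apply: eq_bigr => v _; rewrite inE; case: (v \in A); case: (a v p).
Qed.

Lemma nbrs_subset (A O : {set T}) r : A \subset O -> nbrs A r <= nbrs O r.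
Proof.
move=> AO; rewrite -!card_trace; apply: subset_leq_card.
by apply/subsetP => v; rewrite !inE => /andP[/(subsetP AO) -> ->].
Qed.

(** Excluding [A] keeps pairs with one end in [A] apart from pairs of poles. *)
Definition poles (A : {set T}) : {set T} := [set r | nbrs A r == 2] :\: A.

(** The pairs are ordered; the two traces together hold four distinct points of [O]. *)
Definition quads (O : {set T}) : {set T * T} :=
  [set x | [&& x.1 \in poles O, x.2 \in poles O, a x.1 x.2
             & [disjoint trace O x.1 & trace O x.2]]].

(* An adjacent pair (p, r) of poles that is not a quad has a common neighbour v
   in O; as v <> p, the pair (v, p) determines r, and p has two neighbours v. *)
Lemma card_quads_adjacent (O : {set T}) :
  \sum_(p in poles O) nbrs (poles O) p <= #|quads O| + 2 * #|poles O|.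
Proof.
have -> : #|quads O| = \sum_(p in poles O) \sum_(r in poles O) ((p, r) \in quads O).
  rewrite pair_big /= -sum1_card big_mkcond [RHS]big_mkcond /=.
  apply: eq_bigr => -[p r] _ /=; rewrite inE /=.
  by case: (p \in _); case: (r \in _).
rewrite [2 * _]mulnC -sum_nat_const -big_split /=; apply: leq_sum => p pY.
have [pO /eqP p2] : p \notin O /\ nbrs O p == 2 by move: pY; rewrite !inE => /andP.
rewrite -p2.
have -> : nbrs O p = \sum_(v in O) a v p * \sum_r (a v r * a p r).
  apply: eq_bigr => v vO; rewrite a_codeg ?muln1 //.
  by apply: contraNneq pO => <-.
apply: leq_trans (_ : _ <= \sum_(r in poles O)
   (((p, r) \in quads O) + \sum_(v in O) a v p * (a v r * a p r))) _; last first.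
  rewrite big_split leq_add2l exchange_big; apply: leq_sum => v _.
  rewrite big_distrr /= big_mkcond; apply: leq_sum => r _.
  by case: ifP.
apply: leq_sum => r rY; rewrite inE /= pY rY /= a_sym.
case: (boolP (a p r)) => //= apr; case: (boolP [disjoint _ & _]) => //=.
move=> /pred0Pn[v /andP[/=]]; rewrite !inE => /andP[vO avp] /andP[_ avr].
by rewrite (bigD1 v) //= avp avr.
Qed.

(** Each pole of [A] gives two ordered pairs into [A] and two out of it, disjoint from the surviving
    quads. At most [#|A|] vertices with two neighbours in [A] lie in [A] itself, which costs
    [4 * #|A|]. *)
Lemma card_adjacent_pairs_ge (A O : {set T}) : A \subset O ->
  (forall r, nbrs O r <= 2) ->
  let V := A :|: [set r | nbrs A r == 2] in
  4 * 'C(#|A|, 2) +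
    #|[set x in quads O | trace O x.1 :|: trace O x.2 \subset A]|
  <= #|[set x | [&& x.1 \in V, x.2 \in V & a x.1 x.2]]| + 4 * #|A|.
Proof.
move=> AO O2 /=; set V := A :|: [set r | nbrs A r == 2].
have A2 r : nbrs A r <= 2.
  exact: leq_trans (nbrs_subset r AO) (O2 r).
have cpoles : 'C(#|A|, 2) <= #|poles A| + #|A|.
  rewrite -(card_secants A2) -(cardsID A) addnC leq_add2l.
  by apply: subset_leq_card; apply: subsetIr.
have poles2 : \sum_(p in poles A) \sum_(v in A) a v p = 2 * #|poles A|.
  rewrite mulnC -sum_nat_const; apply: eq_bigr => p.
  by rewrite !inE => /andP[_ /eqP].
set N := [set x in quads O | _]; set D := finset _.
have NA x : x \in N -> [&& x.1 \in poles A, x.2 \in poles A & a x.1 x.2].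
  have NA1 p : p \in poles O -> trace O p \subset A -> p \in poles A.
    rewrite !inE => /andP[pO p2] /subsetP pA.
    rewrite (contra (subsetP AO p) pO) /= -(eqP p2) -!card_trace; apply/eqP.
    apply: eq_card => v; move: (pA v); rewrite !inE.
    case: (boolP (v \in A)) => [vA|_ h]; first by rewrite (subsetP AO v).
    by apply/esym/negP => /h.
  rewrite inE => /andP[]; rewrite inE => /and4P[x1 x2 ax _].
  by rewrite subUset => /andP[/NA1-> // /NA1-> //].
pose P1 := [set x | [&& x.1 \in A, x.2 \in poles A & a x.1 x.2]].
pose P2 := [set x | [&& x.1 \in poles A, x.2 \in A & a x.1 x.2]].
have cP1 : #|P1| = 2 * #|poles A|.
  rewrite -poles2 exchange_big pair_big -sum1_card big_mkcond [RHS]big_mkcond /=.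
  by apply: eq_bigr => -[v p] _; rewrite inE /=;
    case: (v \in A); case: (p \in poles A); case: (a v p).
have cP2 : #|P2| = 2 * #|poles A|.
  rewrite -poles2 pair_big -sum1_card big_mkcond [RHS]big_mkcond /=.
  by apply: eq_bigr => -[p v] _; rewrite inE /= a_sym;
    case: (v \in A); case: (p \in poles A); case: (a v p).
suff : #|P1| + #|P2| + #|N| <= #|D|.
  have lin c p k n d : c <= p + k -> 2 * p + 2 * p + n <= d -> 4 * c + n <= d + 4 * k by lia.
  by rewrite cP1 cP2; apply: lin.
have cE (P : {set T * T}) : #|P| = \sum_x (x \in P).
  by rewrite -sum1_card big_mkcond; apply: eq_bigr => x _; case: (x \in P).
rewrite !cE -!big_split /=; apply: leq_sum => x _.
case: (boolP (x \in N)) => [/NA|_]; rewrite !inE.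
  by case/and3P => /andP[/negPf-> ->] /andP[/negPf-> ->] ->; rewrite ?orbT.
by case: (x.1 \in A); case: (x.2 \in A); case: (nbrs A x.1 == 2);
  case: (nbrs A x.2 == 2); case: (a _ _).
Qed.

(** * Variance estimate and the number of quads *)

Local Open Scope ring_scope.

(* The nbrs Y r have mean about c = |Y|/q and total squared deviation at most
   q|Y| over all vertices; summing (nbrs Y p - c + s)^2 >= 0 over Y concludes. *)
Lemma mixing (R : realFieldType) (s : R) (Y : {set T}) :
  1 <= s -> s ^+ 2 = q%:R ->
  #|Y|%:R ^+ 2 / q%:R - s * #|Y|%:R <= (\sum_(p in Y) nbrs Y p)%:R :> R.
Proof.
move=> s1 sq; have s0 : 0 < s by lra.
have q1 : 1 <= q%:R :> R by rewrite -sq; nra.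
have [->|[v vY]] := set_0Vmem Y; first by rewrite cards0 expr0n /= mul0r mulr0 subrr.
set y : R := #|Y|%:R; pose c := y / q%:R.
have cq : c * q%:R = y by rewrite /c divfK //; apply: lt0r_neq0; lra.
pose d p : R := (nbrs Y p)%:R.
have Sd : \sum_p d p = y * (q%:R + 1).
  by rewrite -natr_sum sum_nbrs natrM -natr1.
have Sd2 : \sum_p d p ^+ 2 = y * (q%:R + y).
  rewrite /y -natrD -natrM -sum_nbrs2 natr_sum; apply: eq_bigr => p _.
  by rewrite natrX.
(* Since y = c q, the sum equals q y - (q - 1) c^2. *)
have Sdc : \sum_p (d p - c) ^+ 2 <= q%:R * y.
  have -> : \sum_p (d p - c) ^+ 2 =
      \sum_p d p ^+ 2 - 2 * c * \sum_p d p + c ^+ 2 * #|T|%:R.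
    rewrite mulr_sumr -sumrB -sum1_card natr_sum mulr_sumr -big_split /=.
    by apply: eq_bigr => p _; ring.
  rewrite Sd Sd2 (card_vertices v) !natrD natrX -cq; nra.
(* The shift [s] makes the variance bound q y equal to the term s^2 y, so dividing by 2 s loses s y
   in total. *)
have SY : 0 <= \sum_(p in Y) (d p - c + s) ^+ 2 by apply: sumr_ge0 => p _; apply: sqr_ge0.
have SYE : \sum_(p in Y) (d p - c + s) ^+ 2 =
    \sum_(p in Y) (d p - c) ^+ 2 + 2 * s * \sum_(p in Y) d p
      + (s ^+ 2 - 2 * s * c) * y.
  rewrite mulr_sumr /y -sum1_card natr_sum mulr_sumr -!big_split /=.
  by apply: eq_bigr => p _; ring.
have SYT : \sum_(p in Y) (d p - c) ^+ 2 <= \sum_p (d p - c) ^+ 2.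
  rewrite [leRHS](bigID (mem Y)) /= lerDl.
  by apply: sumr_ge0 => p _; apply: sqr_ge0.
rewrite natr_sum -/(d _) -(ler_pM2l (_ : 0 < 2 * s)); last by lra.
rewrite -cq.
have -> : (c * q%:R) ^+ 2 / q%:R = c * y by rewrite expr2 cq mulrAC -/c mulrC mulrA.
move: SY; rewrite SYE; nra.
Qed.

(** There are q^2/2 + O(q) poles, so [mixing] has main term q^3/4 (ordered pairs) and loss O(s q^2);
    the non-quads cost only O(q^2). *)
Lemma card_quads_ge (R : realFieldType) (s : R) (O : {set T}) :
  1 <= s -> s ^+ 2 = q%:R -> #|O| = q.+1 -> (forall r, (nbrs O r <= 2)%N) ->
  q%:R ^+ 3 / 4 - 5 * s ^+ 5 <= #|quads O|%:R :> R.
Proof.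
move=> s1 sq cO O2.
have := mixing (poles O) s1 sq; have := card_quads_adjacent O.
rewrite -(ler_nat R) natrD natrM; set M : R := (\sum_(p in _) _)%:R.
set E : R := #|quads O|%:R; set y : R := #|poles O|%:R => h1 h2.
have cs := card_secants O2.
have e2 : 2 * 'C(q.+1, 2)%:R = q%:R * (q%:R + 1) :> R.
  rewrite natr1 -!natrM; congr _%:R.
  by have := mul_bin_diag q.+1 1; rewrite bin1 /=; lia.
have y_le : 2 * y <= q%:R * (q%:R + 1).
  rewrite -e2 ler_pM2l // ler_nat -cO -cs.
  by apply: subset_leq_card; apply: subsetDl.
have y_ge : (q%:R + 1) * (q%:R - 2) <= 2 * y.
  have : 'C(q.+1, 2)%:R <= y + (q%:R + 1).
    rewrite natr1 -natrD ler_nat -cO -cs -(cardsID O) addnC leq_add2l.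
    by apply: subset_leq_card; apply: subsetIr.
  lra.
(* The claimed bound is s^5 (s - 20)/4, trivial up to s = 20; beyond that, lower powers of s are
   absorbed into s^5. *)
have [s20|s20] := leP s 20.
  apply: le_trans (ler0n _ _); rewrite -sq -exprM.
  have -> : s ^+ (2 * 3) = s * s ^+ 5 by rewrite -exprS.
  have : 0 <= s ^+ 5 by apply: exprn_ge0; lra.
  nra.
move: h2 y_le y_ge; rewrite -sq; set z := y ^+ 2 / _ => h2 y_le y_ge.
have zy : z * s ^+ 2 = y ^+ 2.
  by rewrite /z divfK // expf_neq0 //; apply: lt0r_neq0; lra.
have z_ge : (s ^+ 2) ^+ 3 - 2 * (s ^+ 2) ^+ 2 - 3 * s ^+ 2 <= 4 * z.
  have Q400 : 400 <= s ^+ 2 by nra.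
  rewrite -(ler_pM2r (_ : 0 < s ^+ 2)); last by lra.
  have : ((s ^+ 2 + 1) * (s ^+ 2 - 2)) ^+ 2 <= (2 * y) ^+ 2.
    by rewrite ler_sqr // nnegrE; nra.
  by rewrite -[4 * z * _]mulrA zy; lra.
have sy : 2 * (s * y) <= s * (s ^+ 2 * (s ^+ 2 + 1)).
  by rewrite mulrCA ler_pM2l //; lra.
have p1 : s ^+ 2 <= s ^+ 5 by apply: ler_weXn2l.
have p2 : s ^+ 3 <= s ^+ 5 by apply: ler_weXn2l.
have p3 : s ^+ 4 <= s ^+ 5 by apply: ler_weXn2l.
have p0 : 0 <= s ^+ 2 by apply: sqr_ge0.
lra.
Qed.

End PolarityGraph.

(** * Numerical form of the edge bound *)

Local Open Scope ring_scope.

Lemma ffact4_ge (R : realDomainType) (m : nat) :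
  m%:R ^+ 4 - 6 * m%:R ^+ 3 <= (m ^_ 4)%:R :> R.
Proof.
suff : (m ^ 4 <= m ^_ 4 + 6 * m ^ 3)%N.
  by rewrite -(ler_nat R) natrD natrM !natrX; lra.
by rewrite !ffactnS ffactn0 muln1; case: m => [|[|[|[|m]]]] //=; nia.
Qed.

Lemma ffact4_le (q : nat) : (q.+1 ^_ 4 <= q ^ 4)%N.
Proof. by rewrite !ffactnS ffactn0 muln1; case: q => [|[|[|q]]] //=; nia. Qed.

(** Here [c] counts pairs in the chosen set, [F] edges, [E] all quads and [N] the surviving ones.
    With s the root of q and m = s x, the gain is s^2 x^4/8 and the error terms are s x^4 and s
    x. *)
Lemma edge_bound (R : realType) (q m c F N E : nat) :
  (4 * c + N <= 2 * F + 4 * m)%N ->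
  (E * m ^_ 4 <= N * q.+1 ^_ 4)%N ->
  (forall s : R, 1 <= s -> s ^+ 2 = q%:R -> q%:R ^+ 3 / 4 - 5 * s ^+ 5 <= E%:R) ->
  2 * c%:R + m%:R ^+ 4 / (8 * q%:R) - 5 * (m%:R ^+ 4 / (q%:R `^ (3 / 2)) + m%:R)
    <= F%:R :> R.
Proof.
move=> hF0 hN0 hE.
have hF : 4 * c%:R + N%:R <= 2 * F%:R + 4 * m%:R :> R by rewrite -!natrM -!natrD ler_nat.
have hN : E%:R * (m ^_ 4)%:R <= N%:R * (q.+1 ^_ 4)%:R :> R by rewrite -2!natrM ler_nat.
have m0 : 0 <= m%:R :> R by [].
have N0 : 0 <= N%:R :> R by [].
(* At q = 0 both quotients are 0 by the convention for inverses. *)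
have [q0|q_gt0] := posnP q.
  by rewrite q0 mulr0 invr0 mulr0 powR0 ?invr0 ?mulr0; lra.
have q1 : 1 <= q%:R :> R by rewrite ler1n.
pose s : R := Num.sqrt q%:R.
have sq : s ^+ 2 = q%:R by rewrite sqr_sqrtr //; lra.
have s1 : 1 <= s by rewrite -sqrtr1 ler_wsqrtr.
have s0 : s != 0 by apply: lt0r_neq0; lra.
have -> : q%:R `^ (3 / 2) = s ^+ 3.
  by rewrite mulrC powRrM powR12_sqrt ?powR_mulrn ?sqrtr_ge0 //; lra.
pose x := m%:R / s; have mE : m%:R = s * x by rewrite mulrC divfK.
have x0 : 0 <= x by apply: divr_ge0; lra.
have := hE s s1 sq; rewrite -sq mE => {}hE.
have -> : (s * x) ^+ 4 / (8 * s ^+ 2) = s * (s * x ^+ 4) / 8 by field.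
have -> : (s * x) ^+ 4 / s ^+ 3 = s * x ^+ 4 by field.
have x4 : 0 <= s * x ^+ 4 by rewrite mulr_ge0 ?exprn_ge0 //; lra.
have [s20|s20] := leP s 20.
  have : s * (s * x ^+ 4) <= 20 * (s * x ^+ 4) by apply: ler_wpM2r.
  by move: m0; rewrite mE; lra.
(* The factors s^5 from [E] and s^3 from [m ^_ 4] cancel q^4 = s^8, which bounds [q.+1 ^_ 4]. *)
have key : (s - 20) / 4 * (s * x ^+ 4 - 6 * x ^+ 3) <= N%:R.
  rewrite -(ler_pM2r (_ : 0 < s ^+ 8)); last by apply: exprn_gt0; lra.
  apply: le_trans (_ : N%:R * (q.+1 ^_ 4)%:R <= _); last first.
    rewrite ler_wpM2l // (_ : s ^+ 8 = (q ^ 4)%:R) ?ler_nat ?ffact4_le //.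
    by rewrite natrX -sq -exprM.
  apply: le_trans hN.
  apply: le_trans (_ : ((s ^+ 2) ^+ 3 / 4 - 5 * s ^+ 5) * (m ^_ 4)%:R <= _); last first.
    exact: ler_wpM2r.
  have := ffact4_ge R m; rewrite mE => hm.
  have e0 : 0 <= (s ^+ 2) ^+ 3 / 4 - 5 * s ^+ 5.
    have -> : (s ^+ 2) ^+ 3 / 4 - 5 * s ^+ 5 = s ^+ 5 * ((s - 20) / 4) by field.
    by apply: mulr_ge0; [apply: exprn_ge0|]; lra.
  by apply: le_trans (ler_wpM2l e0 hm); rewrite le_eqVlt; apply/orP; left; apply/eqP; field.
have x3 : 0 <= x ^+ 3 by apply: exprn_ge0.
(* This splits the cubic term between the two error terms. *)
have sx : s * x ^+ 3 <= s * x ^+ 4 + s * x.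
  rewrite -mulrDr ler_pM2l; last by lra.
  have : 0 <= x * (x ^+ 3 - x ^+ 2 + 1) by apply: mulr_ge0 => //; have [|] := leP x 1; nra.
  by lra.
move: hF key; rewrite mE; lra.
Qed.

(** * The polarity graph of a projective plane *)

Section PolarityPlane.

Variables (q : nat) (G : geometry) (pi : element G -> element G).
Hypothesis planeG : projective_plane q G.
Hypothesis pol : polarity pi.

Definition adjacent : rel (point G) :=
  fun p r => incident_elt (inl p) (pi (inl r)).

Lemma adjacent_sym : symmetric adjacent.
Proof.
move=> p r; rewrite /adjacent -(polarity_incident pol) (polarity_invol pol).
by case: (polarity_point pol p) => l ->.
Qed.

Lemma adjacent_deg p : (\sum_r adjacent p r = q.+1)%N.
Proof.
case: (polarity_point pol p) => l pl.
rewrite -(card_line planeG l) -sum1_card [RHS]big_mkcond /=.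
by apply: eq_bigr => r _; rewrite inE adjacent_sym /adjacent pl /=; case: incident.
Qed.

(** The common neighbours are the points on both polar lines, which differ because [pi] is
    injective. *)
Lemma adjacent_codeg p p' :
  p != p' -> (\sum_r adjacent p r * adjacent p' r = 1)%N.
Proof.
move=> pp'.
case: (polarity_point pol p) (polarity_point pol p') => [l pl] [k pk].
have lk : l <> k.
  move=> lk; move: pl; rewrite lk -pk => /(inv_inj (polarity_invol pol)) [e].
  by rewrite e eqxx in pp'.
have [r [[rl rk] r_uniq]] := unique_meet planeG lk.
have E x : (adjacent p x * adjacent p' x)%N = (x == r).
  rewrite !(adjacent_sym _ x) /adjacent pl pk /= mulnb; congr nat_of_bool.
  apply/andP/eqP => [[xl xk]|-> //].
  by rewrite (r_uniq x).
rewrite (eq_bigr (fun x => nat_of_bool (x == r))) // (bigD1 r) //= eqxx big1 //.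
by move=> x /negPf->.
Qed.

(** All neighbours of [r] lie on its polar line. *)
Lemma oval_nbrs (O : {set point G}) r : oval q O -> (nbrs adjacent O r <= 2)%N.
Proof.
move=> [_ O3]; rewrite -card_trace leqNgt; apply/negP => /card_gt2P.
move=> [x [y [z [[]]]]]; rewrite !inE => /andP[xO xr] /andP[yO yr] /andP[zO zr].
move=> [/eqP xy /eqP yz /eqP zx].
apply: (O3 x y z) => //; first by move=> xz; apply: zx.
case: (polarity_point pol r) => l rl; exists l.
by move: xr yr zr; rewrite /adjacent rl.
Qed.

Lemma polarity_edge p r : adjacent p r -> [set p; r] \in polarity_edges pi.
Proof.
move=> apr; rewrite inE; apply/existsP; exists p; apply/existsP; exists r.
by rewrite eqxx.
Qed.

End PolarityPlane.

Theorem theorem1 (R : realType) :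
  exists C : R,
  forall (q : nat) (G : geometry) (pi : element G -> element G),
    projective_plane q G ->
    (exists O : {set point G}, oval q O) ->
    polarity pi ->
    forall m : nat, (1 <= m <= q.+1)%N ->
    exists (V : {set point G}) (F : {set {set point G}}),
      [/\ subgraph (polarity_edges pi) V F,
          (#|V| <= m + 'C(m, 2))%N &
          2 * 'C(m, 2)%:R + m%:R ^+ 4 / (8 * q%:R)
            - C * (m%:R ^+ 4 / (q%:R `^ (3 / 2)) + m%:R)
          <= #|F|%:R :> R].
Proof.
exists 5 => q G pi planeG [O ovalO] pol m /andP[_ mq].
pose a := adjacent pi.
have asym := adjacent_sym pol.
have adeg := adjacent_deg planeG pol.
have acodeg := adjacent_codeg planeG pol.
have O2 r : (nbrs a O r <= 2)%N by apply: (oval_nbrs pol r ovalO).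
have cO : #|O| = q.+1 by case: ovalO.
pose S (x : point G * point G) := trace a O x.1 :|: trace a O x.2.
have S4 x : x \in quads a O -> #|S x| = 4.
  rewrite inE => /and4P[]; rewrite !inE => /andP[_ /eqP x1] /andP[_ /eqP x2] _ dx.
  by rewrite /S cardsU (disjoint_setI0 dx) cards0 subn0 !card_trace x1 x2.
have SO x : x \in quads a O -> S x \subset O.
  by move=> _; apply/subsetP => v; rewrite !inE => /orP[] /andP[].
have [|A [AO cA leA]] := sub_card_averaging (m := m) S4 SO; first by rewrite cO.
have A2 r : (nbrs a A r <= 2)%N.
  exact: leq_trans (nbrs_subset a r AO) (O2 r).
(* All edges spanned by [V] are taken, loops included. *)
pose V := A :|: [set r | nbrs a A r == 2].
pose D := [set x | [&& x.1 \in V, x.2 \in V & a x.1 x.2]].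
exists V, [set [set x.1; x.2] | x in D]; split.
- split=> [|e].
    apply/subsetP => e /imsetP[x]; rewrite inE => /and3P[_ _ ax] ->.
    exact: polarity_edge.
  move=> /imsetP[x]; rewrite inE => /and3P[xV yV _] ->.
  by rewrite subUset !sub1set xV.
- rewrite -cA -(card_secants adeg acodeg A2).
  by rewrite cardsU leq_subr.
apply: edge_bound.
- have := card_adjacent_pairs_ge asym adeg acodeg AO O2; rewrite cA => h.
  apply: leq_trans h _; rewrite leq_add2r; exact: card_unordered_pairs.
- by rewrite -cO; exact: leA.
by move=> s s1 sq; apply: (card_quads_ge asym adeg acodeg s1 sq cO O2).
Qed.
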